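(* Suppose that $I\subset S$ is a homogeneous $\mathfrak m$-primary ideal, and let $\operatorname{in} I$ denote the initial ideal of $I$ with respect to the reverse lexicographic order on the monomials of $S$. Let $1\le p\le n$. If $m= t_p(S/I)$ then $$(x_1,\dots,x_{p})^{m-p+1} \subset \operatorname{in} I.$$ In particular, if $I$ is generated in degree $d$ and the resolution of $I$ is linear for $p-1$ steps, then the initial ideal of $I$ in reverse lexicographic order contains $(x_1,\dots,x_{p})^d$.
   Context: $K$ is a field, $S=K[x_1,\dots,x_n]$ is the polynomial ring graded with $\deg x_i=1$, and $\mathfrak m=(x_1,\dots,x_n)$. The order is the (degree) reverse lexicographic order with $x_1>\cdots>x_n$. For a finitely generated graded $S$-module $A$, $t_p(A)=\sup\{i\mid \operatorname{Tor}^S_p(A,K)_i\ne 0\}$, the maximal degree of a minimal generator of the $p$-th syzygies of $A$. The resolution of an ideal $I$ generated in degree $d$ is linear for $q$ steps if for $0\le i\le q$ the $i$-th free module in the minimal graded free resolution of $I$ (starting with $i=0$ for the generators) is generated in degree $d+i$. *)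

(* Defs.v *)
From HB Require Import structures.
From mathcomp Require Import all_boot all_order all_algebra.
From mathcomp Require Import mpoly.

Set Implicit Arguments.
Unset Strict Implicit.
Unset Printing Implicit Defensive.

Import GRing.Theory.
Local Open Scope ring_scope.

(** The polynomial ring S = K[x_1, ..., x_n] is [{mpoly K[n]}], with x_(i+1)
    written ['X_i] for [i : 'I_n].  Subsets of S are [Prop]-valued predicates,
    so that no decidability of membership is assumed. *)

Section Ideals.
Variables (n : nat) (K : fieldType).
Local Notation S := {mpoly K[n]}.
Implicit Types (I J G : S -> Prop) (f g : S).

Definition is_ideal I : Prop :=
  [/\ I 0, forall f g, I f -> I g -> I (f + g)
    & forall f g, I g -> I (f * g)].

Definition ideal_gen G : S -> Prop :=
  fun f => forall J, is_ideal J -> (forall g, G g -> J g) -> J f.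

Definition ideal_pow J (k : nat) : S -> Prop :=
  ideal_gen (fun g => exists2 a : 'I_k -> S,
    forall i, J (a i) & g = \prod_(i < k) a i).

(* The ideal (x_1, ..., x_p). *)
Definition var_ideal (p : nat) : S -> Prop :=
  ideal_gen (fun g => exists2 i : 'I_n, (i < p)%N & g = 'X_i).

Definition irrelevant_ideal : S -> Prop := var_ideal n.

Definition homogeneous_ideal I : Prop :=
  is_ideal I /\ forall f d, I f -> I (pihomog mdeg d f).

Definition primary_ideal I : Prop :=
  [/\ is_ideal I, ~ I 1
    & forall f g, I (f * g) -> I f \/ exists k, I (g ^+ k)].

Definition radical I : S -> Prop := fun f => exists k, I (f ^+ k).

Definition m_primary I : Prop :=
  primary_ideal I /\ forall f, radical I f <-> irrelevant_ideal f.

Definition generated_in_degree I (d : nat) : Prop :=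
  forall f, I f <-> ideal_gen (fun g => I g /\ g \is d.-homog) f.

End Ideals.

(** Degree reverse lexicographic order with x_1 > ... > x_n: in equal degrees,
    the monomial with the larger exponent at the last difference is the smaller
    one.  The order [(m1 <= m2)%O] that the library puts on ['X_{1..n}] (and so
    [mlead]) cannot be used here: its documentation calls it degrevlex, but it
    breaks ties lexicographically from the first variable. *)
Definition drevlex_lt (n : nat) (m1 m2 : 'X_{1..n}) : Prop :=
  (mdeg m1 < mdeg m2)%N \/
  mdeg m1 = mdeg m2 /\
  exists i : 'I_n, (m2 i < m1 i)%N /\
    forall j : 'I_n, (i < j)%N -> m1 j = m2 j.

Definition initial_monomial (n : nat) (K : fieldType)
    (f : {mpoly K[n]}) (m : 'X_{1..n}) : Prop :=
  m \in msupp f /\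
  forall m', m' \in msupp f -> m' != m -> drevlex_lt m' m.

Definition initial_ideal (n : nat) (K : fieldType)
    (I : {mpoly K[n]} -> Prop) : {mpoly K[n]} -> Prop :=
  ideal_gen (fun g => exists f m,
    [/\ I f, initial_monomial f m & g = 'X_[m]]).

(** A sequence  ... -> F_2 -> F_1 -> F_0 -> S  of maps out of finitely generated
    free modules  F_i = (+)_k S(- fdeg i k),  k < frank i.  Elements of F_i are
    row vectors and maps act by right multiplication: [fdif i] is the matrix of
    F_(i+1) -> F_i and [faug] that of F_0 -> S.  The modules resolved below are
    subquotients of S, so generators have natural-number degrees. *)
Record free_seq (n : nat) (K : fieldType) := FreeSeq {
  frank : nat -> nat;
  fdeg : forall i, 'I_(frank i) -> nat;
  faug : 'cV[{mpoly K[n]}]_(frank 0);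
  fdif : forall i, 'M[{mpoly K[n]}]_(frank i.+1, frank i)
}.
Arguments frank {n K} f i.
Arguments fdeg {n K} f i k.
Arguments faug {n K} f.
Arguments fdif {n K} f i.

Section Resolutions.
Variables (n : nat) (K : fieldType).
Local Notation S := {mpoly K[n]}.
Implicit Types (I M N : S -> Prop) (F : free_seq n K).

(* The maps are homogeneous of degree 0; a zero entry is allowed anywhere. *)
Definition graded_seq F : Prop :=
  (forall k, faug F k ord0 \is (fdeg F 0 k).-homog) /\
  (forall i k l, fdif F i k l = 0 \/
     exists2 e : nat, fdeg F i.+1 k = (fdeg F i l + e)%N
                    & fdif F i k l \is e.-homog).

Definition aug_val F (v : 'rV[S]_(frank F 0)) : S := (v *m faug F) ord0 ord0.

(* For homogeneous ideals N <= M of S: F is a graded free resolution of M/N,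
   where F_0 -> M/N is induced by [faug].  The cases used are S/I and I/0. *)
Definition graded_free_resolution M N F : Prop :=
  [/\ graded_seq F,
      forall v : 'rV_(frank F 0), M (aug_val v),
      forall f, M f -> exists v : 'rV_(frank F 0), N (f - aug_val v),
      forall v : 'rV_(frank F 0),
        N (aug_val v) <-> exists w, v = w *m fdif F 0
    & forall i (v : 'rV_(frank F i.+1)),
        v *m fdif F i = 0 <-> exists w, v = w *m fdif F i.+1].

Definition minimal_seq F : Prop :=
  forall i k l, irrelevant_ideal (fdif F i k l).

(* The differential of F (x) K, where K = S/m: an entry is sent to its constant
   coefficient. *)
Definition fdifK F i : 'M[K]_(frank F i.+1, frank F i) :=
  map_mx (mcoeff 0%MM) (fdif F i).

Definition cycleK F p : 'rV[K]_(frank F p) -> Prop :=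
  match p with
  | 0 => fun=> True
  | q.+1 => fun v => v *m fdifK F q = 0
  end.

Definition boundaryK F p (v : 'rV[K]_(frank F p)) : Prop :=
  exists w, v = w *m fdifK F p.

(* H_p(F (x) K)_j <> 0 *)
Definition homologyK_neq0 F (p j : nat) : Prop :=
  exists v : 'rV[K]_(frank F p),
    [/\ forall k, v ord0 k != 0 -> fdeg F p k = j,
        cycleK v & ~ boundaryK v].

(* Tor^S_p(M/N, K)_j <> 0; the choice of the resolution does not matter. *)
Definition Tor_neq0 M N (p j : nat) : Prop :=
  exists2 F, graded_free_resolution M N F & homologyK_neq0 F p j.

(* m = t_p(S/I) = sup {j | Tor_p(S/I, K)_j <> 0}.  A natural number is the
   supremum of a set of degrees (with sup of the empty set being -oo) exactly
   when it is its maximum. *)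
Definition is_t I (p m : nat) : Prop :=
  Tor_neq0 (fun=> True) I p m /\
  forall j, Tor_neq0 (fun=> True) I p j -> (j <= m)%N.

(* For I generated in degree d: the minimal graded free resolution of I (it is
   unique up to isomorphism) is linear for q steps. *)
Definition linear_for_steps I (d q : nat) : Prop :=
  exists F, [/\ graded_free_resolution I (fun f => f = 0) F, minimal_seq F
    & forall i, (i <= q)%N -> forall k, fdeg F i k = (d + i)%N].

End Resolutions.

(* Main.v *)
From HB Require Import structures.
Require Import Defs.
From mathcomp Require Import all_boot all_order all_algebra.
From mathcomp Require Import mpoly.

(** Write q = (x_(p+1), ..., x_n), t = t_p(S/I), and fix N > 0 such that every
    x_i^N lies in I.

    Reduction to a statement modulo q.  Let x^a be a monomial in x_1, ..., x_p
    only, with x^a = g modulo q for some g in I.  The degree-|a| component of g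
    is still in I, and all its monomials except x^a are divisible by one of
    x_(p+1), ..., x_n, so they are smaller than x^a in reverse lexicographic
    order: x^a is the initial monomial of that component
    ([revlex_initial]).  It remains to see that x^a is in I + q as soon as
    |a| > t - p ([quotient_bound]).

    That is a bound on the top degree of S/(I + q), usually obtained from local
    cohomology.  Here is an argument with chains only.  Let F be a graded free
    resolution of S/I and J_k = q + (x_1^N, ..., x_k^N).  Multiplication by
    x_(k+1)^N is null-homotopic on F, because x_(k+1)^N kills S/I.  Applying the
    homotopies for x_1^N, ..., x_p^N one after the other to a lift v_0 of 1 gives
    elements v_k of F_k, homogeneous of degree kN, with

      d(v_(k+1)) = x_(k+1)^N v_k  modulo J_k F_k.

    The class of v_k detects membership in I + q: if w v_k lies in
    J_k F_k + d(F_(k+1)), then w lies in I + q.  For k = 0 this is exactness of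
    F at F_0.  For the step, apply d to w v_(k+1) = x_(k+1)^N a + c + d(b), where
    c is in J_k F_(k+1): then x_(k+1)^N (w v_k - d(a)) is in J_k F_k, and
    x_(k+1)^N is a nonzerodivisor modulo J_k ([detecting_cycle]).

    Finally the degrees.  As Tor_p(S/I, K) vanishes above degree t, the element
    v_p, whose boundary lies in J_p F_(p-1), is congruent modulo
    J_p F_p + d(F_(p+1)) to an element supported on the generators of F_p of
    degree at most t ([cycle_low_rep]).  Its coefficients have degree at least
    pN - t, those of x^a v_p have degree at least pN - t + |a| > p(N - 1), and
    every form of such a degree is in J_p.  So w = x^a satisfies the hypothesis
    above with k = p.

    For the statement on linear resolutions, prepend S to the given resolution of
    I ([shift_resolution]); the generators of F_p then all have degree
    d + p - 1. *)

Set Implicit Arguments.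
Unset Strict Implicit.
Unset Printing Implicit Defensive.

Import GRing.Theory.
Local Open Scope ring_scope.

(** * Ideals as predicates *)

Section IdealTheory.
Variables (n : nat) (K : fieldType).
Local Notation S := {mpoly K[n]}.
Implicit Types (I J G : S -> Prop) (f g : S).

Lemma idealN J f : is_ideal J -> J f -> J (- f).
Proof. by case=> _ _ JM Jf; rewrite -mulN1r; apply: JM. Qed.

Lemma idealB J f g : is_ideal J -> J f -> J g -> J (f - g).
Proof. by move=> iJ Jf Jg; case: (iJ) => _ JD _; apply: JD => //; apply: idealN. Qed.

Lemma idealMr J f g : is_ideal J -> J f -> J (f * g).
Proof. by case=> _ _ JM Jf; rewrite mulrC; apply: JM. Qed.

Lemma ideal_sum J (T : Type) (r : seq T) (P : pred T) (F : T -> S) :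
  is_ideal J -> (forall i, P i -> J (F i)) -> J (\sum_(i <- r | P i) F i).
Proof. by case=> J0 JD _ JF; elim/big_ind: _. Qed.

Lemma ideal_gen_ideal G : is_ideal (ideal_gen G).
Proof.
split=> [J [] // | f g If Ig J iJ GJ | f g Ig J iJ GJ]; case: (iJ) => _ JD JM.
  by apply: JD; [apply: If | apply: Ig].
by apply: JM; apply: Ig.
Qed.

Lemma ideal_gen_in G g : G g -> ideal_gen G g.
Proof. by move=> Gg J _; apply. Qed.

End IdealTheory.

(** * Monomial ideals *)

Section MonomialIdeal.
Variables (n : nat) (K : fieldType).
Local Notation S := {mpoly K[n]}.
Implicit Types (f g : S) (P : pred 'X_{1..n}).

Definition upclosed P := forall m k, P m -> P (m + k)%MM.

(** For an upward closed [P], the ideal spanned by the monomials that satisfy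
    [P]. *)
Definition monideal P f : Prop := forall m, m \in msupp f -> P m.

Lemma monidealP P f :
  monideal P f <-> forall m, ~~ P m -> f@_m = 0.
Proof.
split=> Pf m; first by apply: contraNeq; rewrite -mcoeff_msupp; apply: Pf.
by rewrite mcoeff_msupp; apply: contraR => /Pf ->.
Qed.

Lemma monideal_ideal P : upclosed P -> is_ideal (monideal P).
Proof.
move=> upP; split=> [m | f g Pf Pg m | f g Pg m].
- by rewrite msupp0.
- by move=> /msuppD_le; rewrite mem_cat => /orP[/Pf | /Pg].
- by move=> /msuppM_le /allpairsP[[a b] /= [_ /Pg Pb ->]]; rewrite addmC; apply: upP.
Qed.

Lemma monidealX P m : P m -> monideal P 'X_[m].
Proof. by move=> Pm k; rewrite msuppX inE => /eqP ->. Qed.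

Lemma monideal_sub P (J : S -> Prop) f :
  is_ideal J -> (forall m, P m -> J 'X_[m]) -> monideal P f -> J f.
Proof.
move=> iJ PJ Pf; rewrite [f]mpolyE big_seq; apply: ideal_sum => // m /Pf /PJ Jm.
by case: (iJ) => _ _ JM; rewrite -mul_mpolyC; apply: JM.
Qed.

Lemma mcoeff_pihomog d f m :
  (pihomog mdeg d f)@_m = if mdeg m == d then f@_m else 0.
Proof.
have monE k : (pihomog mdeg d 'X_[k] : S)@_m = if mdeg m == d then ('X_[k] : S)@_m else 0.
  rewrite pihomogX /=; case: (eqVneq k m) => [-> | km].
    by case: ifP; rewrite ?mcoeff0.
  by case: ifP => _; rewrite ?mcoeff0 mcoeffX (negPf km) ?if_same.
rewrite [f in LHS]mpolyE [f in RHS]mpolyE.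
rewrite (linear_sum (pihomog mdeg d)) !(raddf_sum (mcoeff m)) /=.
case: ifP monE => _ monE; [apply: eq_bigr | apply: big1_seq] => k _.
  by rewrite linearZ /= [LHS]mcoeffZ monE mcoeffZ.
by rewrite linearZ /= [LHS]mcoeffZ monE mulr0.
Qed.

End MonomialIdeal.

(** * Homogeneous components in a shifted grading *)

Section HomogeneousPart.
Variables (n : nat) (K : fieldType).
Local Notation S := {mpoly K[n]}.
Implicit Types (f g : S).

(** The component of degree [D] of [f] as an element of S(-a), i.e. as the
    coefficient of a generator of degree [a]; the test avoids the truncated
    difference [D - a] when the generator has degree above [D]. *)
Definition hpart (D a : nat) f : S :=
  if (a <= D)%N then pihomog mdeg (D - a) f else 0.

Lemma hpart_is_linear D a : linear (hpart D a).
Proof.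
by move=> c f g; rewrite /hpart; case: ifP => _; rewrite ?linearP ?scaler0 ?addr0.
Qed.
HB.instance Definition _ D a :=
  GRing.isLinear.Build K S S _ (hpart D a) (hpart_is_linear D a).

Lemma mcoeff_hpart D a f m :
  (hpart D a f)@_m = if (mdeg m + a == D)%N then f@_m else 0.
Proof.
rewrite /hpart; case: leqP => aD; first by rewrite mcoeff_pihomog -(eqn_add2r a) subnK.
by rewrite mcoeff0 gtn_eqF // ltn_addl.
Qed.

Lemma hpartM D a e f g : g \is e.-homog ->
  hpart D a (f * g) = hpart D (a + e) f * g.
Proof.
move=> hg; rewrite [f]mpolyE mulr_suml !linear_sum /= mulr_suml.
apply: eq_bigr => m _; rewrite -scalerAl !linearZ /= -scalerAl; congr (_ *: _).
have hm : ('X_[m] * g : S) \is (mdeg m + e).-homog by apply: dhomogM; rewrite ?dhomogX.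
(* By linearity f is a monomial, and then both sides are forms, which taking a
   component either keeps or kills. *)
have homogE b c (h : S) : h \is c.-homog -> hpart D b h = if (c + b == D)%N then h else 0.
  move=> hh; apply/mpolyP => k; rewrite mcoeff_hpart [in RHS]fun_if mcoeff0.
  have [<- // | /(dhomog_nemf_coeff hh) ->] := eqVneq (mdeg k) c.
  by rewrite !if_same.
rewrite (homogE _ _ _ hm) (homogE _ (mdeg m)) ?dhomogX // -addnA [(e + a)%N]addnC.
by case: ifP; rewrite ?mul0r.
Qed.

End HomogeneousPart.

(** * The ideals generated by some variables and by powers of others *)

Section VarCut.
Variables (n : nat) (K : fieldType).
Local Notation S := {mpoly K[n]}.
Implicit Types (f g : S) (p N k : nat) (m : 'X_{1..n}).

(** The monomials of (x_(p+1), ..., x_n). *)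
Definition tailmon p m := [exists i : 'I_n, (p <= i)%N && (0 < m i)%N].

(** The monomials of (x_1^N, ..., x_k^N, x_(p+1), ..., x_n). *)
Definition cutmon p N k m :=
  tailmon p m || [exists i : 'I_n, (i < k)%N && (N <= m i)%N].

Lemma tailmon_up p : upclosed (@tailmon p).
Proof.
move=> m k /existsP[i /andP[pi mi]]; apply/existsP; exists i.
by rewrite pi mnmDE addn_gt0 mi.
Qed.

Lemma cutmon_up p N k : upclosed (@cutmon p N k).
Proof.
move=> m m' /orP[/tailmon_up tm | /existsP[i /andP[ik Nm]]].
  by rewrite /cutmon tm.
apply/orP; right; apply/existsP; exists i.
by rewrite ik mnmDE (leq_trans Nm) ?leq_addr.
Qed.

Lemma cutmon0 p N : cutmon p N 0 =1 tailmon p.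
Proof.
by move=> m; rewrite /cutmon; case: existsP => [[i]|]; rewrite ?ltn0 // orbF.
Qed.

Lemma cutmonS p N (k : 'I_n) m :
  cutmon p N k.+1 m = cutmon p N k m || (N <= m k)%N.
Proof.
rewrite /cutmon -orbA; congr (_ || _); apply/existsP/orP.
  move=> [i /andP[]]; rewrite ltnS leq_eqVlt => /orP[/eqP/val_inj -> | ik] Nm.
    by right.
  by left; apply/existsP; exists i; rewrite ik.
case=> [/existsP[i /andP[ik Nm]] | Nm]; last by exists k; rewrite ltnSn.
by exists i; rewrite Nm ltnS ltnW.
Qed.

(** For [k < p] the variable ['X_k] occurs in no generator of the ideal, so
    multiplying a monomial by its powers does not affect membership: ['X_k ^+ N]
    is a nonzerodivisor modulo the ideal. *)
Lemma cut_var_colon p N (k : 'I_n) f : (k < p)%N ->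
  monideal (cutmon p N k) ('X_k ^+ N * f) -> monideal (cutmon p N k) f.
Proof.
move=> kp /monidealP h; apply/monidealP => m mP.
rewrite -(mcoeffMX f (U_(k) *+ N)%MM) -mpolyXn mulrC h //.
apply: contra mP => /orP[] /existsP[i /andP[ik]]; rewrite mnmDE mulmnE mnm1E.
  have /negPf -> : k != i by apply: contraTneq ik => <-; rewrite -ltnNge.
  by rewrite mul0n add0n => mi; apply/orP; left; apply/existsP; exists i; rewrite ik.
have /negPf -> : k != i by apply: contraTneq ik => <-; rewrite ltnn.
by rewrite mul0n add0n => mi; apply/orP; right; apply/existsP; exists i; rewrite ik.
Qed.

Lemma cut_var_decomp p N (k : 'I_n) f : monideal (cutmon p N k.+1) f ->
  exists a, monideal (cutmon p N k) (f - 'X_k ^+ N * a).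
Proof.
have iJ := @monideal_ideal n K _ (@cutmon_up p N k).
have [J0 JD JM] := iJ.
apply: (@monideal_sub _ _ _ (fun g => exists a, monideal _ (g - 'X_k ^+ N * a))).
  split=> [|f1 f2 [a1 h1] [a2 h2]|f1 f2 [a h]].
  - by exists 0; rewrite mulr0 subr0.
  - by exists (a1 + a2); rewrite mulrDr opprD addrACA; apply: JD.
  - by exists (f1 * a); rewrite mulrCA -mulrBr; apply: JM.
move=> m; rewrite cutmonS => /orP[mP | Nm].
  by exists 0; rewrite mulr0 subr0; apply: monidealX.
exists 'X_[m - U_(k) *+ N]; rewrite mpolyXn -mpolyXD addmC submK ?subrr //.
apply/mnm_lepP => i; rewrite mulmnE mnm1E.
by case: eqP => [<- | _] //; rewrite mul1n.
Qed.

(** Pigeonhole: a monomial in p variables with all exponents below N has degree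
    at most p(N - 1). *)
Lemma cutmon_of_mdeg p N m : (p <= n)%N -> (0 < N)%N ->
  (p * N < mdeg m + p)%N -> cutmon p N p m.
Proof.
case: N => // N pn _; apply: contraTT.
rewrite negb_or => /andP[/existsPn tm /existsPn hm].
have h (i : 'I_n) : (m i <= if (i < p)%N then N else 0)%N.
  have := tm i; have := hm i; case: ltnP => ip /=; first by rewrite -ltnNge ltnS.
  by rewrite -leqNgt.
rewrite -leqNgt mulnS addnC leq_add2l mdegE.
apply: leq_trans (leq_sum _ (fun i _ => h i)) _.
by rewrite -big_mkcond -(big_ord_widen _ (fun=> N) pn) sum_nat_const card_ord.
Qed.

End VarCut.

(** * Initial monomials in reverse lexicographic order *)

Section Revlex.
Variables (n : nat) (K : fieldType).
Local Notation S := {mpoly K[n]}.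
Implicit Types (I : S -> Prop) (f g : S) (p s : nat) (m a : 'X_{1..n}).

(** This is where the choice of the order matters: among monomials of one degree,
    reverse lexicographic order puts every multiple of one of the last variables
    below every monomial in the first [p] variables. *)
Lemma revlex_initial I p a g : homogeneous_ideal I -> ~~ tailmon p a ->
  I g -> monideal (tailmon p) ('X_[a] - g) -> initial_ideal I 'X_[a].
Proof.
move=> [iI hI] na Ig h; apply: ideal_gen_in.
exists (pihomog mdeg (mdeg a) g), a.
have low m : m != a -> m \in msupp (pihomog mdeg (mdeg a) g) ->
    (mdeg m == mdeg a) && tailmon p m.
  move=> ma; rewrite mcoeff_msupp mcoeff_pihomog.
  case: ifP => [_ gm | _ /eqP /(_ erefl) []].
  apply: h; rewrite mcoeff_msupp mcoeffB mcoeffX.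
  by rewrite [a == m]eq_sym (negPf ma) sub0r oppr_eq0.
split=> //; first exact: hI.
split.
  rewrite mcoeff_msupp mcoeff_pihomog eqxx; apply: contra na => /eqP ga.
  by apply: h; rewrite mcoeff_msupp mcoeffB mcoeffX eqxx ga subr0 oner_eq0.
move=> m ms ma; have /andP[/eqP dm /existsP[j /andP[pj mj]]] := low _ ma ms.
right; split=> //.
have a0 (i : 'I_n) : (p <= i)%N -> a i = 0%N.
  move=> pi; apply/eqP; rewrite -leqn0 leqNgt; apply: contra na => ai.
  by apply/existsP; exists i; rewrite pi.
have dj : m j != a j by rewrite a0 // -lt0n.
(* The last index at which m and a differ is at least j, hence in the range where
   a has exponent zero. *)
case: (@arg_maxnP _ j (fun i => m i != a i) (fun i : 'I_n => i : nat) dj) => i mi imax.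
have ij := imax _ dj.
exists i; split=> [|k ik].
  by move: mi; rewrite a0 ?(leq_trans pj) // lt0n.
by apply/eqP; apply: contraLR ik => /imax; rewrite -leqNgt.
Qed.

Definition lowdeg p m := (\sum_(i < n | (i < p)%N) m i)%N.

Lemma lowdegD p m1 m2 : lowdeg p (m1 + m2)%MM = (lowdeg p m1 + lowdeg p m2)%N.
Proof. by rewrite /lowdeg -big_split; apply: eq_bigr => i _; rewrite mnmDE. Qed.

Lemma lowdeg_up p s : upclosed (fun m => (s <= lowdeg p m)%N).
Proof. by move=> m k sm; rewrite lowdegD (leq_trans sm) ?leq_addr. Qed.

Lemma var_ideal_lowdeg p f :
  var_ideal p f -> monideal (fun m => (1 <= lowdeg p m)%N) f.
Proof.
apply=> [|_ [i ip ->]]; first exact/monideal_ideal/lowdeg_up.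
by apply: monidealX; rewrite /lowdeg (bigD1 i) //= mnm1E eqxx.
Qed.

Lemma var_ideal_pow_lowdeg p s f :
  ideal_pow (var_ideal p) s f -> monideal (fun m => (s <= lowdeg p m)%N) f.
Proof.
apply=> [|_ [a va ->]]; first exact/monideal_ideal/lowdeg_up.
elim: s a va => [|s IH] a va; first by move=> m; rewrite leq0n.
rewrite big_ord_recl => m /msuppM_le /allpairsP[[m1 m2] /= [h1 h2 ->]].
rewrite lowdegD -add1n leq_add //; first exact: var_ideal_lowdeg (va _) _ h1.
exact: IH (fun i => va _) _ h2.
Qed.

Lemma initial_ideal_low_pow I p s :
  (forall a, ~~ tailmon p a -> (s <= mdeg a)%N -> initial_ideal I 'X_[a]) ->
  forall f, ideal_pow (var_ideal p) s f -> initial_ideal I f.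
Proof.
move=> hin f /var_ideal_pow_lowdeg; apply: monideal_sub => [|m sm].
  exact: ideal_gen_ideal.
(* A monomial is a multiple of its part in the first p variables. *)
pose a : 'X_{1..n} := [multinom if (i < p)%N then m i else 0%N | i < n].
have am : (a <= m)%MM by apply/mnm_lepP => i; rewrite mnmE; case: ifP.
rewrite -(submK am) mpolyXD.
have [_ _ JM] := @ideal_gen_ideal n K (fun g => exists f m,
    [/\ I f, initial_monomial f m & g = 'X_[m]]).
apply: JM; apply: hin.
  by rewrite /tailmon; apply/existsPn => i; rewrite mnmE; case: (ltnP i p).
apply: leq_trans sm _; rewrite mdegE /lowdeg big_mkcond leq_sum // => i _.
by rewrite mnmE.
Qed.

End Revlex.

(** * Graded free modules *)

Section GradedVectors.
Variables (n : nat) (K : fieldType).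
Local Notation S := {mpoly K[n]}.

Definition vmem (J : S -> Prop) r (v : 'rV[S]_r) : Prop := forall l, J (v ord0 l).

Lemma vmemD J r (u v : 'rV_r) : is_ideal J -> vmem J u -> vmem J v -> vmem J (u + v).
Proof. by case=> _ JD _ Ju Jv l; rewrite mxE; apply: JD. Qed.

Lemma vmemB J r (u v : 'rV_r) : is_ideal J -> vmem J u -> vmem J v -> vmem J (u - v).
Proof. by move=> iJ Ju Jv l; rewrite !mxE; apply: idealB. Qed.

Lemma vmemN J r (v : 'rV_r) : is_ideal J -> vmem J v -> vmem J (- v).
Proof. by move=> iJ Jv l; rewrite mxE; apply: idealN. Qed.

Lemma vmemZ J r c (v : 'rV_r) : is_ideal J -> vmem J v -> vmem J (c *: v).
Proof. by case=> _ _ JM Jv l; rewrite mxE; apply: JM. Qed.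

Lemma vmemZl J r c (v : 'rV_r) : is_ideal J -> J c -> vmem J (c *: v).
Proof. by move=> iJ Jc l; rewrite mxE; apply: idealMr. Qed.

Lemma vmem_mulmx J r s (v : 'rV_r) (M : 'M_(r, s)) :
  is_ideal J -> vmem J v -> vmem J (v *m M).
Proof.
by move=> iJ Jv l; rewrite mxE; apply: ideal_sum => // k _; apply: idealMr.
Qed.

(** The component of degree [D] in the graded free module with generators in
    degrees [deg]. *)
Definition rpart D r (deg : 'I_r -> nat) (v : 'rV[S]_r) : 'rV[S]_r :=
  \row_k hpart D (deg k) (v ord0 k).

Lemma rpartB D r deg (u v : 'rV_r) : rpart D deg (u - v) = rpart D deg u - rpart D deg v.
Proof. by apply/rowP=> k; rewrite !mxE linearB. Qed.

Definition graded_mx r s (degr : 'I_r -> nat) (degc : 'I_s -> nat) (M : 'M[S]_(r, s)) :=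
  forall k l, M k l = 0 \/ exists2 e, degr k = (degc l + e)%N & M k l \is e.-homog.

Lemma rpart_mulmx D r s degr degc (v : 'rV_r) (M : 'M_(r, s)) :
  graded_mx degr degc M -> rpart D degc (v *m M) = rpart D degr v *m M.
Proof.
move=> gM; apply/rowP=> l; rewrite !mxE linear_sum; apply: eq_bigr => k _.
rewrite mxE; case: (gM k l) => [-> | [e -> he]]; last exact: hpartM.
by rewrite !mulr0 linear0.
Qed.

Lemma rpart_scale D N r deg y (v : 'rV_r) : y \is N.-homog ->
  rpart (D + N) deg (y *: v) = y *: rpart D deg v.
Proof.
move=> hy; apply/rowP=> k; rewrite !mxE mulrC (hpartM _ _ _ hy) mulrC.
by congr (_ * _); apply/mpolyP=> m; rewrite !mcoeff_hpart addnA eqn_add2r.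
Qed.

Lemma monideal_hpart P D a (f : S) : monideal P f -> monideal P (hpart D a f).
Proof.
move=> /monidealP Pf; apply/monidealP=> m /Pf.
by rewrite mcoeff_hpart => ->; rewrite if_same.
Qed.

Lemma hpart_mdeg D a (f : S) m : m \in msupp (hpart D a f) -> (mdeg m + a = D)%N.
Proof. by rewrite mcoeff_msupp mcoeff_hpart; case: ifP => [/eqP | _ /eqP]. Qed.

Lemma vmem_rpart P D r deg (v : 'rV_r) :
  vmem (monideal P) v -> vmem (monideal P) (rpart D deg v).
Proof. by move=> Pv l; rewrite mxE; apply: monideal_hpart. Qed.

Lemma rpart_id D r deg (v : 'rV_r) : rpart D deg (rpart D deg v) = rpart D deg v.
Proof.
apply/rowP=> k; rewrite !mxE; apply/mpolyP=> m.
by rewrite !mcoeff_hpart; case: ifP => // ->.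
Qed.

Lemma mulmx_rows r s t (M : 'M[S]_(r, t)) (A : 'M[S]_(s, t)) :
  (forall i, exists w, row i M = w *m A) -> exists W, M = W *m A.
Proof.
move=> /fin_all_exists[w hw]; exists (\matrix_i w i).
by apply/row_matrixP=> i; rewrite row_mul rowK.
Qed.

End GradedVectors.

(** * Pushing cycles to low-degree generators *)

Section LowGenerators.
Variables (n : nat) (K : fieldType).
Local Notation S := {mpoly K[n]}.
Variables (F : free_seq n K) (P : pred 'X_{1..n}).
Hypotheses (gF : graded_seq F) (upP : upclosed P).

Lemma fdif_eq0 i k l : (fdeg F i.+1 k < fdeg F i l)%N -> fdif F i k l = 0.
Proof.
case: gF => _ /(_ i k l)[// | [e -> _]].
by rewrite ltnNge leq_addr.
Qed.

Lemma fdif_const i k l : fdeg F i.+1 k = fdeg F i l ->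
  fdif F i k l = (fdifK F i k l)%:MP.
Proof.
move=> kl; rewrite mxE; case: gF => _ /(_ i k l)[-> | [e]].
  by rewrite mcoeff0 mpolyC0.
rewrite kl -[LHS]addn0 => /addnI <- h; apply/mpolyP=> m; rewrite mcoeffC.
have [-> | m0] := eqVneq m 0%MM; first by rewrite mulr1.
by rewrite mulr0 (dhomog_nemf_coeff h) // mdeg_eq0.
Qed.

Lemma fdifK_eq0 i k l : fdeg F i.+1 k != fdeg F i l -> fdifK F i k l = 0.
Proof.
rewrite mxE; case: gF => _ /(_ i k l)[-> | [e -> h]]; first by rewrite mcoeff0.
rewrite -[X in _ != X]addn0 eqn_add2l => e0.
by rewrite (dhomog_nemf_coeff h) // mf0 eq_sym.
Qed.

Let deg_row i j (u : 'rV[S]_(frank F i)) : 'rV[S]_(frank F i) :=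
  \row_l if fdeg F i l == j then u ord0 l else 0.

Let coeff_row r m (u : 'rV[S]_r) : 'rV[K]_r := map_mx (mcoeff m) u.

Let coeff_row_mul m r s (u : 'rV[S]_r) (A : 'M[K]_(r, s)) :
  coeff_row m (u *m map_mx (@mpolyC n K) A) = coeff_row m u *m A.
Proof.
apply/rowP=> l; rewrite !mxE raddf_sum; apply: eq_bigr => k _.
by rewrite !mxE mulrC /= mcoeffCM mulrC.
Qed.

Let deg_coeff i j m (u : 'rV[S]_(frank F i)) l :
  coeff_row m (deg_row j u) ord0 l = if fdeg F i l == j then (u ord0 l)@_m else 0.
Proof. by rewrite !mxE; case: ifP; rewrite ?mcoeff0. Qed.

(** When the coefficients of [u] on generators of degree above [j] lie in the
    monomial ideal, the coefficients of the boundary of [u] on generators of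
    degree [j] only see, modulo that ideal, the constant entries of the matrix.
    So the coefficients on a monomial outside the ideal form a cycle of F (x) K. *)
Let coeff_cycle q j u m : vmem (monideal P) (u *m fdif F q) ->
  (forall l, (j < fdeg F q.+1 l)%N -> monideal P (u ord0 l)) ->
  ~~ P m -> coeff_row m (deg_row j u) *m fdifK F q = 0.
Proof.
move=> cu hu mP; apply/rowP=> l; rewrite mxE [RHS]mxE.
have [jl | jl] := eqVneq (fdeg F q l) j; last first.
  apply: big1 => k _; rewrite deg_coeff; case: eqP => [kj | _]; last by rewrite mul0r.
  by rewrite fdifK_eq0 ?mulr0 // kj eq_sym.
have /monidealP/(_ _ mP) := cu l; rewrite mxE raddf_sum /= => cu0; rewrite -[RHS]cu0.
apply: eq_bigr => k _; rewrite deg_coeff; case: (ltngtP (fdeg F q.+1 k) j) => kj.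
- by rewrite fdif_eq0 ?jl // mulr0 mul0r mcoeff0.
- have /monidealP/(_ _ mP) -> := idealMr (fdif F q k l) (monideal_ideal K upP) (hu _ kj).
  by rewrite mul0r.
- by rewrite fdif_const ?jl // [(u _ _ * _)]mulrC mcoeffCM mulrC.
Qed.

(** The cycles of F (x) K extracted by [coeff_cycle] are boundaries since the
    homology vanishes in degree [j]; the preimages, assembled over all monomials,
    give the [b] that removes the coefficients on generators of degree [j]. *)
Lemma clear_degree q j (u : 'rV_(frank F q.+1)) :
  ~ homologyK_neq0 F q.+1 j -> vmem (monideal P) (u *m fdif F q) ->
  (forall l, (j < fdeg F q.+1 l)%N -> monideal P (u ord0 l)) ->
  exists b, forall l, (j <= fdeg F q.+1 l)%N ->
    monideal P ((u - b *m fdif F q.+1) ord0 l).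
Proof.
move=> noH cu hu.
(* D is the degree-j part of the differential of F (x) K: E projects onto the
   generators of degree j. *)
pose E : 'M[K]_(frank F q.+2) := diag_mx (\row_k (fdeg F q.+2 k == j)%:R).
pose D := E *m fdifK F q.+1.
have EE k l (A : 'M[K]_(frank F q.+2, l)) i :
    (E *m A) k i = (fdeg F q.+2 k == j)%:R * A k i.
  by rewrite mul_diag_mx !mxE.
have cD m : ~~ P m -> (coeff_row m (deg_row j u) <= D)%MS.
  move=> mP; set c := coeff_row _ _.
  have /submxP[w cw] : (c <= fdifK F q.+1)%MS.
    apply/negP=> /negP nb; apply: noH; exists c; split.
    - by move=> l; rewrite deg_coeff; case: ifP => [/eqP | _ /eqP].
    - exact: coeff_cycle.
    - by case=> w cw; case/negP: nb; apply/submxP; exists w.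
  apply/submxP; exists w; apply/rowP=> l.
  have [lj | lj] := eqVneq (fdeg F q.+1 l) j.
    rewrite {1}cw [LHS]mxE [RHS]mxE; apply: eq_bigr => k _; rewrite EE.
    case: eqVneq => [_ | kj]; first by rewrite mul1r.
    by rewrite fdifK_eq0 ?lj // !mulr0.
  rewrite deg_coeff (negPf lj) mxE big1 // => k _; rewrite EE.
  case: eqVneq => [kj | _]; last by rewrite mul0r mulr0.
  by rewrite fdifK_eq0 ?mulr0 // kj eq_sym.
(* One matrix with constant entries solves c = b D for the coefficient vectors of
   all monomials at once; projecting by E makes the solution homogeneous, which
   keeps its boundary zero on generators of degree above j. *)
pose B := deg_row j u *m map_mx (@mpolyC n K) (pinvmx D) *m map_mx (@mpolyC n K) E.
have Bk k : fdeg F q.+2 k != j -> B ord0 k = 0.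
  move=> /negPf kj; rewrite /B mxE big1 // => i _; rewrite !mxE.
  by have [-> | _] := eqVneq i k; rewrite ?kj ?mul0rn ?mulr0n mpolyC0 mulr0.
exists B => l jl; apply/monidealP=> m mP.
rewrite 2!mxE.
have -> : (B *m fdif F q.+1) ord0 l = (B *m map_mx (@mpolyC n K) (fdifK F q.+1)) ord0 l.
  rewrite !mxE; apply: eq_bigr => k _; rewrite [map_mx _ _ k l]mxE.
  have [kj | /Bk ->] := eqVneq (fdeg F q.+2 k) j; last by rewrite !mul0r.
  move: jl; rewrite leq_eqVlt => /orP[/eqP jl | jl].
    by rewrite fdif_const // kj.
  by rewrite fdif_eq0 ?kj // fdifK_eq0 ?mpolyC0 // kj ltn_eqF.
have BE : ((B *m map_mx (@mpolyC n K) (fdifK F q.+1)) ord0 l)@_m =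
    coeff_row m (deg_row j u) ord0 l.
  transitivity ((coeff_row m B *m fdifK F q.+1) ord0 l).
    by rewrite -coeff_row_mul [RHS]mxE.
  by rewrite !coeff_row_mul -[_ *m E *m _]mulmxA -/D mulmxKpV ?cD.
rewrite mcoeffB BE.
rewrite deg_coeff; move: jl; rewrite leq_eqVlt eq_sym => /orP[-> | jl].
  by rewrite subrr.
by rewrite gtn_eqF // subr0; have /monidealP -> := hu _ jl.
Qed.

(** A relative form of the description of Tor by minimal generators: modulo
    boundaries, a cycle of F / J F can be moved off the generators in the degrees
    where Tor vanishes, even if F is not minimal.  Degrees are cleared from the
    top down by [clear_degree]. *)
Lemma cycle_low_rep q t (v : 'rV_(frank F q.+1)) :
  fdif F q.+1 *m fdif F q = 0 ->
  (forall j, (t < j)%N -> ~ homologyK_neq0 F q.+1 j) ->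
  vmem (monideal P) (v *m fdif F q) ->
  exists b, forall l, (t < fdeg F q.+1 l)%N ->
    monideal P ((v - b *m fdif F q.+1) ord0 l).
Proof.
move=> dd noH cv; pose M := (\max_l fdeg F q.+1 l)%N.
suff main c : exists b, forall l, (t < fdeg F q.+1 l)%N -> (M - c < fdeg F q.+1 l)%N ->
    monideal P ((v - b *m fdif F q.+1) ord0 l).
  have [b hb] := main M; exists b => l tl.
  by apply: hb; rewrite // subnn (leq_trans _ tl).
(* c counts the degrees cleared so far, starting from the largest degree M. *)
elim: c => [|c [b hb]].
  exists 0 => l _; rewrite subn0 ltnNge leq_bigmax //.
have [jt | tj] := leqP (M - c) t.
  by exists b => l tl _; apply: hb => //; apply: leq_ltn_trans tl.
have [||b' hb'] := @clear_degree q (M - c)%N (v - b *m fdif F q.+1) (noH _ tj).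
- by rewrite mulmxBl -mulmxA dd mulmx0 subr0.
- by move=> l jl; apply: hb => //; apply: ltn_trans jl.
exists (b + b') => l tl cl; rewrite mulmxDl opprD addrA; apply: hb'.
by move: cl; rewrite subnS prednK // (leq_ltn_trans _ tj).
Qed.

End LowGenerators.

(** * Detecting membership in I + (x_(p+1), ..., x_n) by cycles *)

Section ResolutionOfQuotient.
Variables (n : nat) (K : fieldType).
Local Notation S := {mpoly K[n]}.
Variables (I : S -> Prop) (F : free_seq n K).
Hypotheses (hI : homogeneous_ideal I).
Hypothesis resF : graded_free_resolution (fun=> True) I F.

Let iI : is_ideal I. Proof. by case: hI. Qed.

Let gF : graded_seq F. Proof. by case: resF. Qed.

Let grF i : graded_mx (fdeg F i.+1) (fdeg F i) (fdif F i).
Proof. by move=> k l; case: gF => _; apply. Qed.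

Let exact_at i r (M : 'M_(r, frank F i.+1)) :
  M *m fdif F i = 0 -> exists W, M = W *m fdif F i.+1.
Proof.
case: resF => _ _ _ _ ex Md; apply: mulmx_rows => k.
by apply/ex; rewrite -row_mul Md row0.
Qed.

Lemma fdif_fdif i : fdif F i.+1 *m fdif F i = 0.
Proof.
case: resF => _ _ _ _ ex; apply/row_matrixP=> k; rewrite row_mul row0.
by apply/ex; exists (delta_mx ord0 k); rewrite -rowE.
Qed.

Lemma aug_val_fdif b : I (aug_val (b *m fdif F 0)).
Proof. by case: resF => _ _ _ ex _; apply/ex; exists b. Qed.

Lemma aug_valB (u v : 'rV_(frank F 0)) :
  aug_val (u - v) = aug_val u - aug_val v.
Proof. by rewrite /aug_val mulmxBl !mxE. Qed.

Lemma aug_valZ c (v : 'rV_(frank F 0)) : aug_val (c *: v) = c * aug_val v.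
Proof. by rewrite /aug_val -scalemxAl mxE. Qed.

Lemma aug_val_rpart D v :
  aug_val (rpart D (fdeg F 0) v) = hpart D 0 (aug_val v).
Proof.
have gA : graded_mx (fdeg F 0) (fun=> 0%N) (faug F).
  move=> k l; right; exists (fdeg F 0 k); rewrite ?add0n // ord1.
  by case: gF.
by rewrite /aug_val -(rpart_mulmx _ _ gA) mxE.
Qed.

(** Multiplication by an element of I is zero on S/I, hence null-homotopic on the
    resolution.  Only two consecutive components of the homotopy are recorded:
    they determine the next one, and no more is used at once. *)
Lemma null_homotopy y k : I y -> exists s s',
  s' *m fdif F k.+1 + fdif F k *m s = y%:M.
Proof.
move=> Iy; elim: k => [|k [s [s' ss']]].
  have [|s hs] := @mulmx_rows n K _ _ _ (y%:M : 'M_(frank F 0)) (fdif F 0).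
    move=> k; case: resF => _ _ _ ex _; apply/ex.
    have -> : row k y%:M = y *: delta_mx ord0 k.
      by rewrite rowE mul_mx_scalar.
    by rewrite aug_valZ; apply: idealMr.
  have [|s' hs'] := @exact_at 0 _ (y%:M - fdif F 0 *m s).
    by rewrite mulmxBl -mulmxA -hs mul_scalar_mx mul_mx_scalar subrr.
  by exists s, s'; rewrite -hs' subrK.
have [|s2 hs2] := @exact_at k.+1 _ (y%:M - fdif F k.+1 *m s').
  rewrite mulmxBl -mulmxA -[s' *m _](addrK (fdif F k *m s)) ss' mulmxBr mulmxA.
  by rewrite fdif_fdif mul0mx subr0 mul_scalar_mx mul_mx_scalar subrr.
by exists s', s2; rewrite -hs2 subrK.
Qed.

(** Cycles of F / J F; every element of F_0 is one. *)
Definition cycle_mod (J : S -> Prop) k : 'rV[S]_(frank F k) -> Prop :=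
  if k is q.+1 then fun v => vmem J (v *m fdif F q) else fun=> True.

(** With [s] the homotopy for [y], take [u := s v]: its boundary is
    [y v - s (d v)], and [s] maps J F to J F. *)
Lemma lift_cycle J y k (v : 'rV_(frank F k)) : is_ideal J -> I y ->
  cycle_mod J v -> exists u, vmem J (u *m fdif F k - y *: v).
Proof.
move=> iJ; case: k v => [|k] v Iy cv.
  case: resF => _ _ _ ex _; have [|u hu] := (ex (y *: v)).1.
    by rewrite aug_valZ; apply: idealMr.
  exists u; rewrite -hu subrr => l; rewrite mxE; by case: iJ.
have [s [s' ss']] := null_homotopy k Iy.
exists (v *m s').
rewrite -mulmxA -[s' *m _](addrK (fdif F k *m s)) ss' mulmxBr mul_mx_scalar.
by rewrite addrAC subrr sub0r mulmxA; apply: vmemN => //; apply: vmem_mulmx.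
Qed.

Section Chain.
Variables (p N : nat).
Hypotheses (le_pn : (p <= n)%N) (powI : forall i : 'I_n, I ('X_i ^+ N)).

Let J k : S -> Prop := monideal (cutmon p N k).
Let iJ k : is_ideal (J k). Proof. exact/monideal_ideal/cutmon_up. Qed.

(** The elements v_k of the argument above, with the property that makes them
    detect membership in I + (x_(p+1), ..., x_n).  The lifts of [lift_cycle] need
    not be homogeneous; taking the component of degree kN makes them so and
    keeps the congruences, because all the ideals are homogeneous. *)
Lemma detecting_cycle k : (k <= p)%N -> exists v : 'rV_(frank F k),
  [/\ rpart (k * N) (fdeg F k) v = v, cycle_mod (J k) v
    & forall w b, vmem (J k) (w *: v - b *m fdif F k) ->
        exists2 g, I g & monideal (tailmon p) (w - g)].
Proof.
elim: k => [_ | k IH kp].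
  have [_ _ surj _ _] := resF; have [v0 hv0] := surj 1 Logic.I.
  pose v := rpart 0 (fdeg F 0) v0.
  have hv : I (1 - aug_val v).
    rewrite /v aug_val_rpart; have -> : (1 : S) = hpart 0 0 1.
      by rewrite /hpart /= pihomog_dE // dhomog1.
    by rewrite -linearB /hpart /=; case: hI => _; apply.
  exists v; split=> // [|w b hb]; first by rewrite mul0n rpart_id.
  exists (w * (1 - aug_val v) + aug_val (b *m fdif F 0)).
    case: (iI) => _ ID IM; apply: ID; [exact: IM | exact: aug_val_fdif].
  rewrite mulrBr mulr1 opprD addrA opprB addrCA subrr addr0 -aug_valZ -aug_valB.
  move=> m hm; rewrite -(cutmon0 _ N); move: m hm.
  by have /(_ ord0) := vmem_mulmx (faug F) (iJ 0) hb.
have [v [hv cv dv]] := IH (ltnW kp).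
pose i : 'I_n := Ordinal (leq_trans kp le_pn); pose y : S := 'X_i ^+ N.
have hy : y \is N.-homog.
  by rewrite -[N]mul1n; apply: dhomogMn; rewrite dhomogX /= mdeg1.
have [u0 hu0] := lift_cycle (iJ k) (powI i) cv.
pose u := rpart (k.+1 * N) (fdeg F k.+1) u0.
have hu : vmem (J k) (u *m fdif F k - y *: v).
  rewrite -(rpart_mulmx _ _ (@grF k)) -[v]hv mulSnr -(rpart_scale _ _ _ hy) -rpartB.
  exact: vmem_rpart.
have JS f : J k f -> J k.+1 f.
  by move=> kf m /kf mk; rewrite (@cutmonS _ _ _ i) mk.
exists u; split=> [||w b hb]; first exact: rpart_id.
  rewrite /= -(subrK (y *: v) (u *m _)); apply: vmemD => [||]; first exact: iJ.
    by move=> l; apply: JS.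
  apply: vmemZl; first exact: iJ.
  rewrite /y mpolyXn; apply: monidealX; rewrite (@cutmonS _ _ _ i).
  by rewrite mulmnE mnm1E eqxx mul1n leqnn orbT.
have /fin_all_exists[a ha] l :
    exists a, J k ((w *: u - b *m fdif F k.+1) ord0 l - y * a).
  exact: (@cut_var_decomp n K p N i _ (hb l)).
apply: (dv w (\row_l a l)) => l.
apply: (@cut_var_colon n K p N i _ kp).
(* The boundary of c expresses y (w v - d a) through elements of J_k F_k. *)
pose c := w *: u - b *m fdif F k.+1 - y *: \row_l a l.
have hc : vmem (J k) c.
  move=> j; have cE (A : 'rV_(frank F k.+1)) :
    (A - y *: \row_l a l) ord0 j = A ord0 j - y * a j by rewrite !mxE.
  by rewrite /c cE.
suff -> : 'X_i ^+ N * (w *: v - \row_l a l *m fdif F k) ord0 l =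
   (c *m fdif F k - w *: (u *m fdif F k - y *: v)) ord0 l.
  exact: (vmemB (iJ k) (vmem_mulmx _ (iJ k) hc) (vmemZ w (iJ k) hu)) l.
rewrite -/y; transitivity ((y *: (w *: v - \row_l a l *m fdif F k)) ord0 l).
  by rewrite [RHS]mxE.
congr (fun_of_matrix _ _ _).
rewrite /c !mulmxBl -mulmxA fdif_fdif mulmx0 subr0 -!scalemxAl !scalerBr !scalerA.
by rewrite opprB [RHS]addrC addrA subrK mulrC.
Qed.

End Chain.

(** The degree count: every coefficient of the low-degree representative of
    x^a v_p has degree above p(N - 1). *)
Lemma quotient_bound q N t a : (q < n)%N -> (0 < N)%N ->
  (forall i : 'I_n, I ('X_i ^+ N)) ->
  (forall j, (t < j)%N -> ~ homologyK_neq0 F q.+1 j) ->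
  (t < mdeg a + q.+1)%N ->
  exists2 g, I g & monideal (tailmon q.+1) ('X_[a] - g : S).
Proof.
move=> qn N0 powI noH ta.
have [v [hv cv dv]] := detecting_cycle qn powI (leqnn q.+1).
have upJ := @cutmon_up n q.+1 N q.+1.
have [b hb] := cycle_low_rep gF upJ (fdif_fdif q) noH cv.
pose D := (q.+1 * N)%N; pose b' := rpart D (fdeg F q.+2) b.
apply: (dv _ ('X_[a] *: b')).
have -> : 'X_[a] *: v - ('X_[a] *: b') *m fdif F q.+1 =
    'X_[a] *: rpart D (fdeg F q.+1) (v - b *m fdif F q.+1).
  by rewrite rpartB hv (rpart_mulmx _ _ (@grF q.+1)) scalerBr scalemxAl.
move=> l; rewrite mxE [rpart _ _ _ _ _]mxE.
have [tl | lt] := ltnP t (fdeg F q.+1 l).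
  have [_ _ JM] := @monideal_ideal n K _ upJ.
  by apply: JM; apply: monideal_hpart; apply: hb.
move=> m /msuppM_le /allpairsP[[m1 m2] /= []].
rewrite msuppX inE => /eqP -> /hpart_mdeg dm ->.
apply: cutmon_of_mdeg => //; rewrite mdegD -/D -dm.
rewrite [(_ + mdeg m2)%N]addnC -addnA ltn_add2l.
exact: leq_ltn_trans lt ta.
Qed.

End ResolutionOfQuotient.

(** * From Tor to initial ideals *)

Section TorBound.
Variables (n : nat) (K : fieldType).
Local Notation S := {mpoly K[n]}.
Implicit Types (I : S -> Prop) (F : free_seq n K).

Lemma m_primary_powers I : m_primary I ->
  exists2 N, (0 < N)%N & forall i : 'I_n, I ('X_i ^+ N).
Proof.
move=> [[[_ _ IM] _ _] radI].
have /fin_all_exists[e he] (i : 'I_n) : exists e, I ('X_i ^+ e).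
  by apply/radI; apply: ideal_gen_in; exists i.
exists (\max_i e i).+1 => // i.
have le_e : (e i <= (\max_i e i).+1)%N by rewrite ltnW // ltnS leq_bigmax.
by rewrite -(subnK le_e) exprD; apply: IM.
Qed.

Lemma initial_ideal_of_Tor_bound I F q t :
  homogeneous_ideal I -> m_primary I ->
  graded_free_resolution (fun=> True) I F -> (q < n)%N ->
  (forall j, (t < j)%N -> ~ homologyK_neq0 F q.+1 j) ->
  forall f, ideal_pow (var_ideal q.+1) (t + 1 - q.+1)%N f -> initial_ideal I f.
Proof.
move=> hI /m_primary_powers[N N0 powI] resF qn noH.
apply: initial_ideal_low_pow => a na; rewrite leq_subLR addn1 addnC => ta.
have [g Ig ga] := quotient_bound hI resF qn N0 powI noH ta.
exact: revlex_initial na Ig ga.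
Qed.

(** The sequence ... -> F_1 -> F_0 -> S with S in position 0. *)
Definition shift_seq F : free_seq n K :=
  @FreeSeq n K (fun i => if i is j.+1 then frank F j else 1%N)
    (fun i => match i return 'I_(if i is j.+1 then frank F j else 1%N) -> nat with
       | 0 => fun=> 0%N
       | j.+1 => fdeg F j
     end)
    1%:M
    (fun i => match i return 'M[S]_(frank F i, if i is j.+1 then frank F j else 1%N) with
       | 0 => faug F
       | j.+1 => fdif F j
     end).

Lemma shift_resolution I F :
  graded_free_resolution I (fun f => f = 0) F ->
  graded_free_resolution (fun=> True) I (shift_seq F).
Proof.
move=> [[gaug gdif] augI surj ex0 ex].
have augE (v : 'rV_1) : @aug_val _ _ (shift_seq F) v = v ord0 ord0.
  by rewrite /aug_val /= mulmx1.
have rowE1 (v : 'rV_1) (w : 'rV_(frank F 0)) :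
    (v = w *m faug F) <-> v ord0 ord0 = aug_val w.
  by split=> [-> | h] //; apply/rowP=> i; rewrite ord1 h.
split=> //.
- split=> [k | [|i] k l] /=; last exact: gdif.
    by rewrite ord1 mxE eqxx dhomog1.
  by right; exists (fdeg F 0 k); rewrite // ord1 gaug.
- move=> f _; exists f%:M; rewrite augE mxE eqxx mulr1n subrr.
  by have := augI 0; rewrite /aug_val mul0mx mxE.
- move=> v; rewrite augE; split=> [/surj[w /eqP] | [w /rowE1 ->]]; last exact: augI.
  by rewrite subr_eq0 => /eqP/rowE1 vw; exists w.
- move=> [|i] v /=; last exact: ex.
  rewrite -ex0; split=> [h | h]; first by rewrite /aug_val h mxE.
  by apply/rowP=> i; rewrite ord1 [RHS]mxE.
Qed.

End TorBound.

Theorem corollary5p3 (K : fieldType) (n : nat) (I : {mpoly K[n]} -> Prop)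
    (hI : homogeneous_ideal I) (hprim : m_primary I)
    (p : nat) (hp1 : (1 <= p)%N) (hpn : (p <= n)%N) :
  (forall m : nat, is_t I p m ->
     forall f : {mpoly K[n]},
       ideal_pow (@var_ideal n K p) (m + 1 - p)%N f -> initial_ideal I f) /\
  (forall d : nat, generated_in_degree I d -> linear_for_steps I d (p - 1)%N ->
     forall f : {mpoly K[n]},
       ideal_pow (@var_ideal n K p) d f -> initial_ideal I f).
Proof.
case: p hp1 hpn => // q _ qn; split=> [m [[F resF _] hmax] | d _ [F [resF _ lin]]].
  apply: (initial_ideal_of_Tor_bound hI hprim resF qn) => j mj Hj.
  by have := hmax j (ex_intro2 _ _ F resF Hj); rewrite leqNgt mj.
(* All generators in position p = q + 1 have degree d + q, so Tor_p vanishes above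
   that degree for trivial reasons. *)
have -> : d = (d + q + 1 - q.+1)%N by rewrite addn1 -addnS addnK.
apply: (initial_ideal_of_Tor_bound hI hprim (shift_resolution resF) qn).
move=> j dj [v [vj _ []]]; exists 0; rewrite mul0mx; apply/rowP=> k.
rewrite mxE; apply/eqP; apply: contraTT dj => /vj <-.
by rewrite -leqNgt /= lin ?subn1.
Qed.
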